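(* There exists a natural number $M$ such that for every natural number $n\ge M$ and every $x\in I=[\tfrac12,1]$, $$\left|f_n(x)-\frac{1}{\ln\frac{10}{9}}\ln\frac{5(x+1)}{3(x+2)}\right|\le 10.9197\cdot 0.66^{\sqrt n}.$$
   Context: Let $A=\{\tfrac12,1\}$ and $I=[\tfrac12,1]$. For positive reals $a_1,a_2,\dots$, $[0;a_1,a_2,\dots]$ denotes the continued fraction $\cfrac{1}{a_1+\cfrac{1}{a_2+\cdots}}$. Every $x\in I$ has an expansion $x=[0;\alpha_1,\alpha_2,\dots]$ with all $\alpha_k\in A$. The expansion is unique except for a countable set of points having exactly two expansions, $[0;b_1,\dots,b_n,\tfrac12,(\tfrac12,1)]=[0;b_1,\dots,b_n,1,(1,\tfrac12)]$ (parentheses denote a period); for these points one of the two expansions is fixed once and for all (the choice does not affect Lebesgue measures). The shift is $T^n([0;\alpha_1,\alpha_2,\dots])=[0;\alpha_{n+1},\alpha_{n+2},\dots]$, a map $I\to I$, and for $S\subseteq I$, $T^{-n}(S)=\{x\in I: T^n(x)\in S\}$. With $\lambda$ Lebesgue measure, $f_n(x)=2\lambda\bigl(T^{-n}([\tfrac12,x])\bigr)$ for $x\in I$. *)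

(* Defs.v *)
From HB Require Import structures.
From mathcomp Require Import all_boot all_order all_algebra.
From mathcomp Require Import all_classical all_reals all_analysis.

Set Implicit Arguments.
Unset Strict Implicit.
Unset Printing Implicit Defensive.

Import Order.TTheory GRing.Theory Num.Theory.
Import numFieldNormedType.Exports.

Local Open Scope classical_set_scope.
Local Open Scope ring_scope.

(* A sequence of partial quotients a_1, a_2, ... is
   encoded as a : nat -> R with a k standing for a_{k+1}. *)

(* cf_convergent a n = [0; a_1, ..., a_n] *)
Fixpoint cf_convergent (R : realType) (a : nat -> R) (n : nat) : R :=
  if n is m.+1 then (a 0%N + cf_convergent (fun k => a k.+1) m)^-1 else 0.

Definition cf_value (R : realType) (a : nat -> R) : R :=
  lim (cf_convergent a n @[n --> \oo]).

Definition A2 (R : realType) : set R := [set 2^-1; 1].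

Definition I2 (R : realType) : set R := `[2^-1, 1].

Definition A2_expansion (R : realType) (x : R) (a : nat -> R) : Prop :=
  (forall k, A2 (a k)) /\ cf_convergent a n @[n --> \oo] --> x.

(* One expansion fixed for each point of I2; only the points having two
   expansions leave any freedom. *)
Definition A2_expansion_choice (R : realType) (e : R -> nat -> R) : Prop :=
  forall x, I2 x -> A2_expansion x (e x).

(* T^n drops the first n digits of the chosen expansion of x. It is not defined
   as an n-fold iterate of T^1: at a point with two expansions, the tail of the
   chosen expansion need not be the expansion chosen for its value. *)
Definition shift (R : realType) (e : R -> nat -> R) (n : nat) (x : R) : R :=
  cf_value (fun k => e x (n + k)%N).

Definition shift_preimage (R : realType) (e : R -> nat -> R) (n : nat)
    (S : set R) : set R :=
  [set x | I2 x /\ S (shift e n x)].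

(* The preimage is contained in I2, so its measure is finite and fine loses
   nothing. *)
Definition f_ (R : realType) (e : R -> nat -> R) (n : nat) (x : R) : R :=
  2 * fine (lebesgue_measure (shift_preimage e n `[2^-1, x])).

(* Main.v *)
Require Import Defs.
From HB Require Import structures.
From mathcomp Require Import all_boot all_order all_algebra.
From mathcomp Require Import all_classical all_reals all_analysis.
From mathcomp Require Import measurable_realfun.
From mathcomp Require Import ring lra.

Set Implicit Arguments.
Unset Strict Implicit.
Unset Printing Implicit Defensive.

Import Order.TTheory GRing.Theory Num.Theory.
Import numFieldNormedType.Exports.

Local Open Scope classical_set_scope.
Local Open Scope ring_scope.

(** The expansion of x is generated by the Gauss-type map G sending x to
    1/x - 1 on [1/2, 2/3] and to 1/x - 1/2 on ]2/3, 1].  The point 2/3 is the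
    only one at which both digits are possible, so, for a fixed n, dropping n
    digits agrees with the n-th iterate of G off the finitely many points whose
    orbit meets 2/3 before time n, whichever expansions are chosen.  Hence f_n
    is the distribution function of the n-th iterate of G under the normalised
    Lebesgue measure, and cutting the event G z <= y along the two branches of
    G gives
      f_(n+1)(y) = f_n(2/3) - f_n(1/(1+y)) + f_n(1) - f_n(1/(1/2+y)).

    Let F(y) = ln (5(y+1)/(3(y+2))).  It satisfies the same recursion, and its
    derivative is 1/((y+1)(y+2)).  Writing f_n' = g_n / ((y+1)(y+2)), the
    recursion becomes an averaging
      g_(n+1)(t) = P(t) g_n(1/(1+t)) + (1 - P(t)) g_n(1/(1/2+t)),
      P(t) = (1+t)/(3+2t).
    On [1/2, 1] the branch t -> 1/(1+t) contracts by 4/9 and carries weight at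
    least 3/8, the other branch does not expand, and P varies slowly; so the
    Lipschitz constant of g_n shrinks by the factor 5/6 at each step
    ([rel_density_lipschitz]).  Thus g_n is within O((5/6)^n) of a constant, and
    the mean value theorem shows that f_n is within O((5/6)^n) of a multiple of
    F ([cdf_rec_approx]).  Evaluating at y = 1, where f_n = 1 and
    F = ln (10/9), identifies that multiple.  The error 10 (5/6)^n is below
    10 * 0.66^(sqrt n) from n = 16 on. *)

(** * Expansions and the Gauss-type map *)

Section Expansions.
Variable R : realType.
Implicit Types (x y : R) (a : nat -> R).

Lemma A2_bounds y : A2 y -> 2^-1 <= y <= 1.
Proof. by case=> ->; lra. Qed.

(** Even convergents start from 0 and odd ones follow them: the alternation
    b <= 1 gives 1/(a+b) >= 1/2, which gives 1/(a+1/(a'+b)) <= 1.  Both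
    subsequences have the limit of the convergents, which confines it to
    [1/2, 1]. *)
Lemma cf_convergent_parity_bounds a n : (forall k, A2 (a k)) ->
  0 <= cf_convergent a n.*2 <= 1 /\ 2^-1 <= cf_convergent a n.*2.+1.
Proof.
move=> ha.
have odd_ge (b c : R) : A2 b -> 0 <= c <= 1 -> 2^-1 <= (b + c)^-1.
  by move=> /A2_bounds hb hc; rewrite lef_pV2 ?posrE //; lra.
elim: n a ha => [|n IH] a ha.
  by split; [rewrite /= lexx ler01 | apply: odd_ge => //=; rewrite lexx ler01].
have even_bounds (b : nat -> R) : (forall k, A2 (b k)) -> 0 <= cf_convergent b n.+1.*2 <= 1.
  move=> hb; have [_ ho] := IH (fun k => b k.+1) (fun k => hb k.+1).
  have /A2_bounds hb0 := hb 0%N.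
  rewrite doubleS -[cf_convergent b _]/((b 0%N + cf_convergent (fun k => b k.+1) n.*2.+1)^-1).
  by rewrite invr_ge0 -[1]invr1 lef_pV2 ?posrE ?invr1; lra.
split; first exact: even_bounds.
by apply: odd_ge => //; apply: (even_bounds (fun k => a k.+1)).
Qed.

Lemma A2_expansion_I2 x a : A2_expansion x a -> 2^-1 <= x <= 1.
Proof.
case=> ha hx; rewrite leNgt [x <= 1]leNgt; apply/andP; split; apply/negP => h.
  (* A limit below 1/2 is ruled out by the odd convergents, a limit above 1 by
     the even ones. *)
  have [N _ HN] := cvgr_lt _ hx _ h.
  have /= := HN N.*2.+1 (leq_trans (leq_addr _ _) (leq_trans (eq_leq (addnn N)) (leqnSn _))).
  by apply/negP; rewrite -leNgt; have [] := cf_convergent_parity_bounds N ha.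
have [N _ HN] := cvgr_gt _ hx _ h.
have /= := HN N.*2 (leq_trans (leq_addr _ _) (eq_leq (addnn N))).
by apply/negP; rewrite -leNgt; have [/andP[]] := cf_convergent_parity_bounds N ha.
Qed.

(** Convergence passes to the tail by inverting the recursion of convergents,
    which is legitimate because x >= 1/2 keeps the inverse continuous. *)
Lemma A2_expansion_tail x a : A2_expansion x a ->
  A2_expansion (x^-1 - a 0%N) (fun k => a k.+1).
Proof.
move=> hxa; have hx := A2_expansion_I2 hxa; case: hxa => ha hcvg.
split=> [k|]; first exact: ha.
have x0 : x != 0 by rewrite gt_eqF //; lra.
have -> : cf_convergent (fun k => a k.+1) =
    (fun n => (cf_convergent a n.+1)^-1 - a 0%N).
  by apply/funext => n /=; rewrite invrK addrAC subrr add0r.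
apply: cvgB; last exact: cvg_cst.
apply: cvgV => //.
by move: hcvg; rewrite -(cvg_shiftS (cf_convergent a)).
Qed.

(** The cylinders of the digits 1 and 1/2 are [1/2, 2/3] and [2/3, 1]; their
    common point 2/3 is put in the first. *)
Definition gauss_map x : R := x^-1 - (if x <= 2 / 3 then 1 else 2^-1).

(** The tail lies in [1/2, 1], which forces the first digit of x once
    x <> 2/3. *)
Lemma gauss_map_expansion x a : A2_expansion x a -> x != 2 / 3 ->
  gauss_map x = x^-1 - a 0%N.
Proof.
move=> hxa x23; have hx := A2_expansion_I2 hxa.
have := A2_expansion_I2 (A2_expansion_tail hxa); rewrite /gauss_map.
have xV : x * x^-1 = 1 by rewrite divff // gt_eqF //; lra.
case: hxa => /(_ 0%N) [] -> _ htail.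
  rewrite ifF //; apply/negP => le_x; case/eqP: x23; apply/le_anti.
  by rewrite le_x; nra.
by rewrite ifT //; nra.
Qed.

Lemma iter_gauss_map_expansion x a n : A2_expansion x a ->
  (forall k, (k < n)%N -> iter k gauss_map x != 2 / 3) ->
  A2_expansion (iter n gauss_map x) (fun k => a (n + k)%N).
Proof.
move=> hxa; elim: n => [//|n IH] hn.
have {}IH := IH (fun k hk => hn k (ltnW hk)).
rewrite iterS (gauss_map_expansion IH (hn n (leqnn _))).
have := A2_expansion_tail IH; congr A2_expansion.
by apply/funext => k; rewrite addnS.
Qed.

Lemma shift_iter_gauss_map (e : R -> nat -> R) n x : A2_expansion_choice e ->
  I2 x -> (forall k, (k < n)%N -> iter k gauss_map x != 2 / 3) ->
  Defs.shift e n x = iter n gauss_map x.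
Proof.
move=> he Ix hn; have [_ hcvg] := iter_gauss_map_expansion (he x Ix) hn.
exact: cvg_lim.
Qed.

Lemma gauss_map_I2 x : 2^-1 <= x <= 1 -> 2^-1 <= gauss_map x <= 1.
Proof.
move=> hx; have xV : x * x^-1 = 1 by rewrite divff // gt_eqF //; lra.
by rewrite /gauss_map; case: ifPn => [|/negP]; rewrite -?ltNge => h; nra.
Qed.

Lemma iter_gauss_map_I2 n x : 2^-1 <= x <= 1 -> 2^-1 <= iter n gauss_map x <= 1.
Proof. by move=> hx; elim: n => [//|n IH]; rewrite iterS; exact: gauss_map_I2. Qed.

(** G is at most two-to-one, with inverse branches c -> 1/(1+c) and
    c -> 1/(1/2+c).  The exceptional points of the n-th shift are fibers over
    2/3, hence finite in number. *)
Lemma finite_iter_gauss_map_fiber n (c : R) :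
  finite_set [set x | iter n gauss_map x = c].
Proof.
elim: n c => [|n IH] c; first exact: finite_set1.
apply: (@sub_finite_set _ _
  ([set x | iter n gauss_map x = (1 + c)^-1] `|`
   [set x | iter n gauss_map x = (2^-1 + c)^-1])); last first.
  by rewrite finite_setU; split; exact: IH.
move=> x /=; set z := iter n gauss_map x; rewrite /gauss_map => <-.
by case: ifP => _; [left|right]; rewrite addrC subrK invrK.
Qed.

End Expansions.

(** * The distribution function of the iterates *)

Section Measures.
Variable R : realType.
Implicit Types (x y : R) (e : R -> nat -> R).
Notation leb := (@lebesgue_measure R).

Lemma finite_set_lebesgue_null (F : set R) : finite_set F ->
  measurable F /\ leb F = 0%E.
Proof.
move=> /finite_set_countable cF.
by split; [exact: countable_measurable | exact: countable_lebesgue_measure0].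
Qed.

(** The set A is automatically measurable: it is B outside F and a subset of
    the finite set F inside.  This is what makes the choice of expansions, and
    the closed or open ends of intervals, irrelevant. *)
Lemma lebesgue_measure_off_finite (F A B : set R) : finite_set F ->
  measurable B -> (forall x, ~ F x -> A x <-> B x) -> leb A = leb B.
Proof.
move=> finF mB AB.
have [mF _] := finite_set_lebesgue_null finF.
have AF : A `\` F = B `\` F by apply/seteqP; split=> x [? nF]; split=> //; apply/AB.
have leb_off C : leb C = leb ((C `\` F) `|` (C `&` F)) by rewrite setUC setUIDK.
have [mAF AF0] := finite_set_lebesgue_null (finite_setIr A finF).
have [mBF BF0] := finite_set_lebesgue_null (finite_setIr B finF).
by rewrite (leb_off A) (leb_off B) AF !measureU0 //; apply: measurableD.
Qed.

Lemma measurable_gauss_map : measurable_fun setT (@gauss_map R).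
Proof.
apply: measurable_funB.
  (* The inverse is discontinuous at 0 only, so 0 is split off. *)
  have -> : [set: R] = [set~ 0] `|` [set 0] by rewrite setUC setUv.
  apply/measurable_funU; rewrite ?measurable_set1 //.
    exact: measurableC.
  split; last exact: measurable_fun_set1.
  apply: open_continuous_measurable_fun.
    by apply: closed_openC; exact: closed_eq.
  by move=> x; rewrite inE /= => /eqP x0; exact: inv_continuous.
apply: measurable_fun_ifT => //.
by apply: measurable_fun_ler.
Qed.

Lemma measurable_iter_gauss_map n : measurable_fun setT (iter n (@gauss_map R)).
Proof.
elim: n => [|n IH]; first exact: measurable_id.
by apply: (measurableT_comp measurable_gauss_map IH).
Qed.

Definition iterate_le n y : set R :=
  `[2^-1, 1] `&` [set x | iter n (@gauss_map R) x <= y].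

Lemma measurable_iterate_le n y : measurable (iterate_le n y).
Proof.
apply: measurableI => //.
rewrite -[X in measurable X]setTI -/(iter n (@gauss_map R) @^-1` [set x | x <= y]).
apply: measurable_iter_gauss_map => //.
by rewrite -set_itvNyc.
Qed.

Definition iterate_cdf n y : R := 2 * fine (leb (iterate_le n y)).

Lemma f_iterate_cdf e n y : A2_expansion_choice e ->
  f_ e n y = iterate_cdf n y.
Proof.
move=> he; rewrite /f_ /iterate_cdf; congr (2 * fine _).
pose F := \bigcup_(k in `I_n) [set x | iter k (@gauss_map R) x = 2 / 3].
apply: (@lebesgue_measure_off_finite F).
- by apply: bigcup_finite => // k _; exact: finite_iter_gauss_map_fiber.
- exact: measurable_iterate_le.
move=> x nF; rewrite /shift_preimage /iterate_le /I2 /=.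
split=> -[Ix hy]; split=> //.
  move: hy; rewrite (shift_iter_gauss_map he) // ?in_itv /=; first by case/andP.
  by move=> k kn; apply/eqP => hk; apply: nF; exists k.
rewrite (shift_iter_gauss_map he) //; last first.
  by move=> k kn; apply/eqP => hk; apply: nF; exists k.
by rewrite in_itv /= hy andbT; case/andP: (iter_gauss_map_I2 n Ix).
Qed.

Lemma iterate_le_fin n y : (leb (iterate_le n y) < +oo)%E.
Proof.
apply: (@le_lt_trans _ _ (leb `[2^-1, 1])).
  by apply: le_measure; rewrite ?inE //; [exact: measurable_iterate_le|move=> x []].
by rewrite lebesgue_measure_itv /=; case: ifP; rewrite ltry.
Qed.

Lemma iterate_cdf0 y : I2 y -> iterate_cdf 0 y = 2 * y - 1.
Proof.
rewrite /I2 /= in_itv /= => hy; rewrite /iterate_cdf.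
have -> : iterate_le 0 y = [set` `[2^-1, y]].
  apply/seteqP; split=> x; rewrite /iterate_le /= !in_itv /=; first by move=> [/andP[-> _] ->].
  by move=> /andP[? ?]; split=> //; lra.
rewrite lebesgue_measure_itv /= lte_fin; case: ltP => h; first by rewrite -EFinB /=; lra.
by rewrite /=; lra.
Qed.

Lemma iterate_cdf_interval n (a b : R) : a <= b ->
  2 * fine (leb (iterate_le n b `\` iterate_le n a)) =
  iterate_cdf n b - iterate_cdf n a.
Proof.
move=> ab; rewrite measureD; last exact: iterate_le_fin.
- have -> : iterate_le n b `&` iterate_le n a = iterate_le n a.
    apply/setIidPr => x [Ix /= hx]; split=> //=; exact: le_trans hx ab.
  by rewrite fineB ?ge0_fin_numE ?iterate_le_fin // mulrBr.
- exact: measurable_iterate_le.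
- exact: measurable_iterate_le.
Qed.

(** For z in [1/2, 1], G z <= y means 1/(1+y) <= z <= 2/3 or
    z >= 1/(1/2+y) with z > 2/3.  The half-open intervals used here differ from
    these only at the end points 1/(1+y) and 1/(1/2+y), whose fibers are
    finite. *)
Lemma iterate_cdfS n y : I2 y ->
  iterate_cdf n.+1 y =
  (iterate_cdf n (2 / 3) - iterate_cdf n (1 + y)^-1) +
  (iterate_cdf n 1 - iterate_cdf n (2^-1 + y)^-1).
Proof.
rewrite /I2 /= in_itv /= => hy.
have [p1 p2] : (1 + y)^-1 * (1 + y) = 1 /\ (2^-1 + y)^-1 * (2^-1 + y) = 1.
  by split; apply: mulVf; rewrite gt_eqF //; lra.
have b1 : (1 + y)^-1 <= 2 / 3 by nra.
have b2 : 2 / 3 <= (2^-1 + y)^-1 <= 1 by nra.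
rewrite -!iterate_cdf_interval //; last by case/andP: b2.
set A := _ `\` _; set B := _ `\` _.
have mA : measurable A by apply: measurableD; exact: measurable_iterate_le.
have mB : measurable B by apply: measurableD; exact: measurable_iterate_le.
have fA : (leb A < +oo)%E.
  by apply: le_lt_trans (iterate_le_fin n (2 / 3)); apply: le_measure;
    rewrite ?inE //; [exact: measurable_iterate_le|move=> x []].
have fB : (leb B < +oo)%E.
  by apply: le_lt_trans (iterate_le_fin n 1); apply: le_measure;
    rewrite ?inE //; [exact: measurable_iterate_le|move=> x []].
rewrite -mulrDr -fineD ?ge0_fin_numE // -measureU //; last first.
  apply/seteqP; split=> // x [[[Ix /= hx] _] [_ hB]]; apply: hB; split=> //=.
  by case/andP: b2 => b2 _; exact: le_trans hx b2.
congr (2 * fine _).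
pose F := [set x | iter n (@gauss_map R) x = (1 + y)^-1] `|`
          [set x | iter n (@gauss_map R) x = (2^-1 + y)^-1].
apply: (@lebesgue_measure_off_finite F).
- by rewrite finite_setU; split; exact: finite_iter_gauss_map_fiber.
- exact: measurableU.
move=> x nF; rewrite /A /B /iterate_le /=.
have := @iter_gauss_map_I2 R n x.
rewrite in_itv /=.
have [z1 z2] : iter n (@gauss_map R) x != (1 + y)^-1 /\ iter n (@gauss_map R) x != (2^-1 + y)^-1.
  by split; apply/eqP => h; apply: nF; [left|right].
move: z1 z2; set z := iter n _ x => z1 z2 Iz.
split.
  move=> [Ix]; have {}Iz := Iz Ix.
  have zV : z * z^-1 = 1 by rewrite divff // gt_eqF //; lra.
  rewrite /gauss_map; case: ifPn => [z23 | /negP]; rewrite -?ltNge => h; [left|right; have z23 := h].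
    split=> // -[_ hz]; case/eqP: z1; apply/le_anti; rewrite hz /=; nra.
  split; first by split=> //; lra.
  move=> -[_ hz]; case/eqP: z2; apply/le_anti; rewrite hz /=; nra.
have lt_of (c : R) : (z <= c -> False) -> c < z by move=> h; rewrite ltNge; apply/negP.
case=> -[[Ix hz] hn]; have {}Iz := Iz Ix; (split; first by []);
  have zV : z * z^-1 = 1 by [rewrite divff // gt_eqF //; lra].
  have {}hn := lt_of _ (fun h => hn (conj Ix h)).
  rewrite /gauss_map hz; nra.
have {}hn := lt_of _ (fun h => hn (conj Ix h)).
rewrite /gauss_map ifF; first nra.
by apply/negP => ?; lra.
Qed.

End Measures.

(** * Contraction of the densities *)

Section Contraction.
Variable R : realType.
Implicit Types (s t x y : R).

(** The density of the n-th distribution relative to 1/((t+1)(t+2)), the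
    density invariant under G up to normalisation.  For this normalisation the
    transfer operator is a weighted mean: the weights below add up to 1. *)
Fixpoint rel_density (n : nat) t : R :=
  if n is m.+1 then
    (1 + t) / (3 + 2 * t) * rel_density m (1 + t)^-1 +
    (2 + t) / (3 + 2 * t) * rel_density m (2^-1 + t)^-1
  else 2 * ((t + 1) * (t + 2)).

(** The recursion of the distribution functions, run on the whole line so that
    they are differentiable at the end points of [1/2, 1] too. *)
Fixpoint cdf_rec (n : nat) y : R :=
  if n is m.+1 then
    (cdf_rec m (2 / 3) - cdf_rec m (1 + y)^-1) +
    (cdf_rec m 1 - cdf_rec m (2^-1 + y)^-1)
  else 2 * y - 1.

Lemma is_derive_cdf_rec n y : 0 < y ->
  is_derive y 1 (cdf_rec n) (rel_density n y / ((y + 1) * (y + 2))).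
Proof.
elim: n y => [|n IH] y y0 /=.
  have -> : 2 * ((y + 1) * (y + 2)) / ((y + 1) * (y + 2)) = 2 *: 1 - 0 :> R.
    by rewrite mulfK ?subr0 /GRing.scale /= ?mulr1 // mulf_neq0 // gt_eqF //; lra.
  by apply: is_deriveB.
have branch (a : R) : 0 < a -> is_derive y 1 (fun z => cdf_rec n (a + z)^-1)
   ((- (a + y) ^- 2) * (rel_density n (a + y)^-1 / (((a + y)^-1 + 1) * ((a + y)^-1 + 2)))).
  move=> a0; have ay : a + y != 0 by rewrite gt_eqF // addr_gt0.
  have dV : is_derive y 1 (fun z : R => (a + z)^-1) (- (a + y) ^- 2).
    have d1 : is_derive y 1 (fun z : R => a + z) (0 + 1) by apply: is_deriveD.
    have := @is_deriveV R (fun z : R => a + z) y _ _ ay d1.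
    by rewrite add0r /GRing.scale /= mulr1.
  rewrite mulrC; apply: is_derive1_comp; first by apply: IH; rewrite invr_gt0 addr_gt0.
have d1 := is_deriveB (is_derive_cst (cdf_rec n (2 / 3)) y 1) (branch 1 ltr01).
have h2 : 0 < 2^-1 :> R by lra.
have d2 := is_deriveB (is_derive_cst (cdf_rec n 1) y 1) (branch 2^-1 h2).
have := is_deriveD d1 d2.
set g1 := rel_density n _; set g2 := rel_density n _.
congr (is_derive _ _ _ _).
by field; rewrite !gt_eqF //; lra.
Qed.

(** With A and B the values of g_n on the two branches and P the first weight,
      g_(n+1)(s) - g_(n+1)(t) =
        P(s) (A(s)-A(t)) + (1-P(s)) (B(s)-B(t)) + (P(s)-P(t)) (A(t)-B(t)).
    The branches contract by 4/9 and 1, P >= 3/8, P is 1/16-Lipschitz, and the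
    images of t under the branches are at distance at most 1/2.  The factor is
    at most 1 - (5/9)(3/8) + 1/32 = 79/96 < 5/6. *)
Lemma rel_density_lipschitz n s t : 2^-1 <= s <= 1 -> 2^-1 <= t <= 1 ->
  `|rel_density n s - rel_density n t| <= 10 * (5 / 6) ^+ n * `|s - t|.
Proof.
elim: n s t => [|n IH] s t hs ht.
  rewrite expr0 mulr1 /=.
  have -> : 2 * ((s + 1) * (s + 2)) - 2 * ((t + 1) * (t + 2)) = 2 * (s + t + 3) * (s - t) by ring.
  by rewrite normrM ler_wpM2r // ger0_norm; lra.
have hV (a u : R) : 2^-1 <= a <= 1 -> 2^-1 <= u <= 1 -> 2^-1 <= (a + u)^-1 <= 1.
  by move=> ha hu; have : (a + u)^-1 * (a + u) = 1 by [apply: mulVf; rewrite gt_eqF //; lra]; nra.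
have h1 : 2^-1 <= (1 : R) <= 1 by lra.
have h2 : 2^-1 <= (2^-1 : R) <= 1 by lra.
have dV (a : R) : 2^-1 <= a <= 1 ->
    `|(a + s)^-1 - (a + t)^-1| = (a + s)^-1 * (a + t)^-1 * `|s - t|.
  move=> ha; have -> : (a + s)^-1 - (a + t)^-1 = (a + s)^-1 * (a + t)^-1 * (t - s).
    by field; rewrite !gt_eqF //; lra.
  rewrite normrM distrC ger0_norm // mulr_ge0 // invr_ge0; lra.
rewrite /= exprS; set K := 10 * _ in IH.
have K0 : 0 <= K by rewrite mulr_ge0 // exprn_ge0 //; lra.
set D := `|s - t|; have D0 : 0 <= D by exact: normr_ge0.
have -> : 10 * (5 / 6 * (5 / 6) ^+ n) * D = 5 / 6 * (K * D) by rewrite /K; ring.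
have E1 : `|rel_density n (1 + s)^-1 - rel_density n (1 + t)^-1| <= 4 / 9 * (K * D).
  apply: le_trans (IH _ _ (hV _ _ h1 hs) (hV _ _ h1 ht)) _.
  rewrite dV // -/D mulrCA ler_wpM2r ?mulr_ge0 //.
  have -> : 4 / 9 = 2 / 3 * (2 / 3) :> R by lra.
  have bV (u : R) : 2^-1 <= u <= 1 -> 0 <= (1 + u)^-1 <= 2 / 3.
    by move=> hu; have : (1 + u)^-1 * (1 + u) = 1 by [apply: mulVf; rewrite gt_eqF //; lra]; nra.
  by case/andP: (bV s hs) => *; case/andP: (bV t ht) => *; apply: ler_pM.
have E2 : `|rel_density n (2^-1 + s)^-1 - rel_density n (2^-1 + t)^-1| <= K * D.
  apply: le_trans (IH _ _ (hV _ _ h2 hs) (hV _ _ h2 ht)) _.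
  rewrite dV // -/D ler_wpM2l // ler_piMl //.
  case/andP: (hV _ _ h2 hs) => *; case/andP: (hV _ _ h2 ht) => *.
  by rewrite mulr_ile1 //; lra.
have E3 : `|rel_density n (1 + t)^-1 - rel_density n (2^-1 + t)^-1| <= 2^-1 * K.
  apply: le_trans (IH _ _ (hV _ _ h1 ht) (hV _ _ h2 ht)) _.
  rewrite mulrC ler_wpM2r // ler_norml.
  by have := hV _ _ h1 ht; have := hV _ _ h2 ht; lra.
move: E1 E2 E3.
set A := rel_density n _; set A' := rel_density n _.
set B := rel_density n _; set B' := rel_density n _ => E1 E2 E3.
set P := (1 + s) / _; set P' := (1 + t) / _.
have [ds dt] : (3 + 2 * s)^-1 * (3 + 2 * s) = 1 /\ (3 + 2 * t)^-1 * (3 + 2 * t) = 1.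
  by split; apply: mulVf; rewrite gt_eqF //; lra.
have -> : (2 + s) / (3 + 2 * s) = 1 - P by rewrite /P; field; rewrite gt_eqF //; lra.
have -> : (2 + t) / (3 + 2 * t) = 1 - P' by rewrite /P'; field; rewrite gt_eqF //; lra.
have hP : 3 / 8 <= P <= 1 by rewrite /P; nra.
have dP : `|P - P'| <= 16^-1 * D.
  have -> : P - P' = (3 + 2 * s)^-1 * (3 + 2 * t)^-1 * (s - t).
    by rewrite /P /P'; field; rewrite !gt_eqF //; lra.
  rewrite normrM ler_wpM2r // ger0_norm; last by rewrite mulr_ge0 // invr_ge0; lra.
  have -> : 16^-1 = 4^-1 * 4^-1 :> R by lra.
  by apply: ler_pM; rewrite ?invr_ge0 ?lef_pV2 ?posrE; lra.
have -> : P * A + (1 - P) * B - (P' * A' + (1 - P') * B') =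
   P * (A - A') + (1 - P) * (B - B') + (P - P') * (A' - B') by ring.
apply: le_trans (ler_normD _ _) _.
have F3 : `|(P - P') * (A' - B')| <= 32^-1 * (K * D).
  rewrite normrM; apply: le_trans (ler_pM _ _ dP E3) _ => //; lra.
have F1 : `|P * (A - A')| <= P * (4 / 9 * (K * D)).
  by rewrite normrM ger0_norm ?ler_wpM2l //; lra.
have F2 : `|(1 - P) * (B - B')| <= (1 - P) * (K * D).
  by rewrite normrM ger0_norm ?ler_wpM2l //; lra.
have := ler_normD (P * (A - A')) ((1 - P) * (B - B')).
have KD : 0 <= K * D by rewrite mulr_ge0.
have PKD : 3 / 8 * (K * D) <= P * (K * D) by rewrite ler_wpM2r //; lra.
by lra.
Qed.

End Contraction.

(** * Convergence to the stationary distribution *)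

Section Limit.
Variable R : realType.
Implicit Types x y : R.

(** The recursion maps the pair of values at 1/2 and 1 to itself because the
    branches send 1/2 to 2/3 and 1, and 1 to 1/2 and 2/3. *)
Lemma cdf_rec_half_one n : cdf_rec n (2^-1 : R) = 0 /\ cdf_rec n (1 : R) = 1.
Proof.
elim: n => [|n [IH0 IH1]] /=; first by split; lra.
have -> : (1 + 2^-1)^-1 = 2 / 3 :> R by field.
have -> : (2^-1 + 2^-1)^-1 = 1 :> R by field.
have -> : (1 + 1)^-1 = 2^-1 :> R by field.
have -> : (2^-1 + 1)^-1 = 2 / 3 :> R by field.
by rewrite IH0 IH1; split; ring.
Qed.

Lemma iterate_cdf_rec n y : I2 y -> iterate_cdf n y = cdf_rec n y.
Proof.
elim: n y => [|n IH] y Iy; first exact: iterate_cdf0.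
rewrite iterate_cdfS //=; move: Iy; rewrite /I2 /= in_itv /= => hy.
have I1 : I2 (1 + y)^-1.
  rewrite /I2 /= in_itv /=.
  by have : (1 + y)^-1 * (1 + y) = 1 by [apply: mulVf; rewrite gt_eqF //; lra]; nra.
have I2' : I2 (2^-1 + y)^-1.
  rewrite /I2 /= in_itv /=.
  by have : (2^-1 + y)^-1 * (2^-1 + y) = 1 by [apply: mulVf; rewrite gt_eqF //; lra]; nra.
by rewrite !IH //; rewrite /I2 /= in_itv /=; lra.
Qed.

(** The invariant distribution function up to the factor ln (10/9), its value
    at 1: the iterates are first compared with an unknown multiple of it. *)
Definition stationary_mass x : R := ln (5 * (x + 1) / (3 * (x + 2))).

Lemma stationary_massE x : 0 < x ->
  stationary_mass x = ln 5 - ln 3 + (ln (x + 1) - ln (x + 2)).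
Proof.
move=> x0; have [x1 x2] : 0 < x + 1 /\ 0 < x + 2 by lra.
by rewrite /stationary_mass ln_div ?posrE ?mulr_gt0 // !lnM ?posrE //; ring.
Qed.

Lemma stationary_mass_half : stationary_mass 2^-1 = 0.
Proof. by rewrite /stationary_mass -[RHS](@ln1 R); congr ln; field. Qed.

Lemma stationary_mass1 : stationary_mass 1 = ln (10 / 9).
Proof. by rewrite /stationary_mass; congr ln; field. Qed.

Lemma stationary_mass_bounds x : 2^-1 <= x <= 1 ->
  0 <= stationary_mass x <= stationary_mass 1.
Proof.
move=> hx; have dV (t : R) : 2^-1 <= t ->
    5 * (t + 1) / (3 * (t + 2)) = 5 / 3 * (1 - (t + 2)^-1).
  by move=> ht; field; rewrite gt_eqF //; lra.
have pV (t : R) : 2^-1 <= t -> (t + 2)^-1 * (t + 2) = 1.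
  by move=> ht; apply: mulVf; rewrite gt_eqF //; lra.
have hhalf : 2^-1 <= 2^-1 :> R by []; have h1 : 2^-1 <= 1 :> R by lra.
have [hx1 _] := andP hx; have := (pV _ hhalf, pV _ hx1, pV _ h1) => -[[q0 qx] q1].
rewrite -{1}stationary_mass_half /stationary_mass !dV //.
by rewrite !ler_ln ?posrE; nra.
Qed.

(** The difference vanishes at 1/2 and has derivative
    (g_n - g_n(1/2)) / ((z+1)(z+2)), so the mean value theorem turns the
    Lipschitz bound on g_n into a bound on it. *)
Lemma cdf_rec_approx n x : 2^-1 <= x <= 1 ->
  `|cdf_rec n x - rel_density n 2^-1 * stationary_mass x| <= 5 * (5 / 6) ^+ n.
Proof.
move=> /andP[hx x1]; set c := rel_density n _.
pose w (z : R) := cdf_rec n z - c * (ln (z + 1) - ln (z + 2)).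
pose dw (z : R) := (rel_density n z - c) / ((z + 1) * (z + 2)).
have dlog (a z : R) : 0 < z -> 0 < a -> is_derive z 1 (fun t : R => ln (t + a)) (z + a)^-1.
  move=> z0 a0; have za := addr_gt0 z0 a0.
  have d1 : is_derive z 1 (fun t : R => t + a) (1 + 0) by apply: is_deriveD.
  have := @is_derive1_comp R (@ln R) (fun t => t + a) z _ _ (is_derive1_ln za) d1.
  by rewrite addr0 mulr1.
have derw (z : R) : 2^-1 <= z -> is_derive z 1 w (dw z).
  move=> hz; have z0 : 0 < z by lra.
  have := is_deriveB (is_derive_cdf_rec n z0)
    (is_deriveZ c (is_deriveB (dlog _ _ z0 ltr01) (dlog _ _ z0 (ltr0n R 2)))).
  congr (is_derive _ _ _ _); rewrite /dw /GRing.scale /=.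
  by field; rewrite !gt_eqF //; lra.
have [||z] := @MVT_segment R w dw 2^-1 x hx.
- by move=> z; rewrite in_itv /= => /andP[hz _]; apply: derw; exact: ltW.
- apply: derivable_within_continuous => z; rewrite in_itv /= => /andP[hz _].
  exact: (@ex_derive _ _ _ _ _ _ _ (derw z hz)).
rewrite in_itv /= => /andP[hz zx].
have -> : w x - w 2^-1 = cdf_rec n x - c * stationary_mass x.
  have [u0 _] := cdf_rec_half_one n.
  have := stationary_mass_half; rewrite /w u0 !stationary_massE; [move=> e0|lra..].
  have -> : ln 5 - ln 3 = - (ln (2^-1 + 1) - ln (2^-1 + 2)) :> R by lra.
  by ring.
move=> ->; rewrite /dw normrM normrM.
have z12 : 1 <= (z + 1) * (z + 2) by nra.
have i12 : `|((z + 1) * (z + 2))^-1| <= 1 by rewrite ger0_norm ?invr_ge0 ?invf_le1; lra.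
have lipz : `|rel_density n z - c| <= 10 * (5 / 6) ^+ n.
  apply: le_trans (@rel_density_lipschitz R n z 2^-1 _ _) _; [lra..|].
  by rewrite ler_piMr ?mulr_ge0 ?exprn_ge0 // ler_norml; lra.
have -> : 5 * (5 / 6) ^+ n = 10 * (5 / 6) ^+ n * 1 * 2^-1 :> R by field.
have ? : `|x - 2^-1| <= 2^-1 by rewrite ler_norml; lra.
by apply: ler_pM => //; rewrite ?mulr_ge0 //; apply: ler_pM.
Qed.

(** Since both distribution functions take the value 1 at 1, the multiple c of
    the previous approximation satisfies |1 - c ln (10/9)| <= 5 (5/6)^n; the two
    errors add up to 10 (5/6)^n. *)
Lemma cdf_rec_stationary n x : 2^-1 <= x <= 1 ->
  `|cdf_rec n x - 1 / ln (10 / 9) * stationary_mass x| <= 10 * (5 / 6) ^+ n.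
Proof.
move=> hx; pose c := rel_density n (2^-1 : R).
have h1 : 2^-1 <= (1 : R) <= 1 by lra.
have := cdf_rec_approx n h1; have [_ ->] := cdf_rec_half_one n.
have := cdf_rec_approx n hx; rewrite -/c -stationary_mass1.
have l0 : 0 < stationary_mass 1 by rewrite stationary_mass1 ln_gt0 //; lra.
have := stationary_mass_bounds hx.
set l := stationary_mass 1 in l0 *; set g := stationary_mass x => hg ax a1.
have -> : cdf_rec n x - 1 / l * g = (cdf_rec n x - c * g) - (g / l) * (1 - c * l).
  by field; rewrite gt_eqF.
apply: le_trans (ler_normB _ _) _.
have -> : 10 * (5 / 6) ^+ n = 5 * (5 / 6) ^+ n + 1 * (5 * (5 / 6) ^+ n) :> R by ring.
apply: lerD => //; rewrite normrM; apply: ler_pM => //.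
rewrite ger0_norm ?divr_ge0 ?ler_pdivrMr //; lra.
Qed.

(** From ln u <= u - 1, ln (5/6) <= -1/6 and ln 0.66 >= -34/66; with
    r = sqrt n, the inequality r^2 / 6 >= 34 r / 66 holds as soon as
    r >= 4. *)
Lemma geometric_le_powR_sqrt n : (16 <= n)%N ->
  (5 / 6) ^+ n <= (66 / 100 : R) `^ Num.sqrt n%:R.
Proof.
move=> hn; set r := Num.sqrt _.
have r4 : 4 <= r.
  have -> : 4 = Num.sqrt (4 ^+ 2) :> R by rewrite sqrtr_sqr ger0_norm.
  by rewrite ler_wsqrtr // -natrX ler_nat.
have rr : r * r = n%:R by rewrite -expr2 sqr_sqrtr.
have -> : (5 / 6) ^+ n = (5 / 6 : R) `^ n%:R by rewrite powR_mulrn //; lra.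
rewrite /powR !gt_eqF; [|lra..].
rewrite ler_expR -rr.
have l1 : ln (5 / 6) <= - (1 / 6) :> R.
  by have -> : 5 / 6 = 1 + - (1 / 6) :> R by [field]; apply: le_ln1Dx; lra.
have l2 : - (34 / 66) <= ln (66 / 100) :> R.
  have -> : 66 / 100 = (1 + 34 / 66)^-1 :> R by field.
  by rewrite lnV ?posrE ?lerN2; [apply: le_ln1Dx; lra|lra].
nra.
Qed.

End Limit.

Theorem corollary15 (R : realType) (e : R -> nat -> R)
    (he : A2_expansion_choice e) :
  exists M : nat, forall (n : nat) (x : R), (M <= n)%N -> I2 x ->
    `| f_ e n x - 1 / ln (10 / 9) * ln (5 * (x + 1) / (3 * (x + 2))) |
      <= (10 + 91 / 10 ^+ 2 + 97 / 10 ^+ 4) * (66 / 100) `^ Num.sqrt (n%:R).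
Proof.
exists 16%N => n x hn Ix.
rewrite (f_iterate_cdf n x he) iterate_cdf_rec //.
move: Ix; rewrite /I2 /= in_itv /= => hx.
apply: le_trans (cdf_rec_stationary n hx) _.
by apply: ler_pM (geometric_le_powR_sqrt R hn); rewrite ?exprn_ge0 //; lra.
Qed.
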